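(* Let $(S,\to,\preceq)$ be a self-simulating transition system and let $I \subseteq S$ be a reachability invariant of it. Let $s_1, t_1 \in S$ with $s_1 \preceq t_1$ and $t_1 \in I$. If $s_1 \to s_2 \to \cdots \to s_n$ is a finite path in $\to$, then there is a path $t_1 \to_{\preceq} t_2 \to_{\preceq} \cdots \to_{\preceq} t_n$ such that $s_i \preceq t_i$ and $t_i \in I$ for all $i$. Similarly, if $s_1 \to s_2 \to \cdots$ is an infinite run in $\to$, then there is an infinite run $t_1 \to_{\preceq} t_2 \to_{\preceq} \cdots$ such that $s_i \preceq t_i$ and $t_i \in I$ for all $i$.
   Context: A transition system $(S,\to)$ consists of a set $S$ and a relation $\to\ \subseteq S\times S$; a path is a finite sequence $s_1\to s_2\to\cdots\to s_n$ and a run is an infinite sequence $s_1 \to s_2 \to \cdots$ with consecutive states related by $\to$. A self-simulating transition system (SSTS) $(S,\to,\preceq)$ is a transition system together with a quasi-order (reflexive and transitive relation) $\preceq$ on $S$ such that for all $s,s',t\in S$: if $s\preceq s'$ and $s\to t$, then there exists $t'$ with $s'\to t'$ and $t\preceq t'$. A set $I\subseteq S$ is a reachability invariant of the SSTS if for all $s\in I$ and all $t$ with $s\to t$ there exists $t'\in I$ with $t\preceq t'$. The relation $\to_{\preceq}$ on $S$ is defined by: $s\to_{\preceq} t'$ iff there exists $t$ with $s\to t$ and $t\preceq t'$. *)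

(* Defs.v *)
From Stdlib Require Import Relation_Definitions.
From mathcomp Require Import ssreflect ssrfun ssrbool eqtype ssrnat fintype.

Set Implicit Arguments.
Unset Strict Implicit.
Unset Printing Implicit Defensive.

(* Stdlib's [preorder] is "reflexive and transitive", i.e. a quasi-order. *)
Record is_ssts (S : Type) (step le : relation S) : Prop := IsSSTS {
  ssts_qo : preorder S le;
  ssts_sim : forall s s' t : S, le s s' -> step s t ->
    exists t' : S, step s' t' /\ le t t'
}.

Definition reach_invariant (S : Type) (step le : relation S) (I : S -> Prop) :
    Prop :=
  forall s t : S, I s -> step s t -> exists t' : S, I t' /\ le t t'.

Definition step_le (S : Type) (step le : relation S) : relation S :=
  fun s t' => exists t : S, step s t /\ le t t'.

(* A path with n+1 states: paths are nonempty, and the states s_1, ..., s_(n+1)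
   are the values of the sequence at 0, ..., n. *)
Definition is_path (S : Type) (R : relation S) (n : nat) (s : 'I_n.+1 -> S) :
    Prop :=
  forall i j : 'I_n.+1, nat_of_ord j = (nat_of_ord i).+1 -> R (s i) (s j).

Definition is_run (S : Type) (R : relation S) (s : nat -> S) : Prop :=
  forall i : nat, R (s i) (s i.+1).

(* Main.v *)
Require Import Defs.
From Stdlib Require Import Relation_Definitions ClassicalEpsilon.
From mathcomp Require Import ssreflect ssrfun ssrbool eqtype ssrnat fintype.

(** The two sequences are matched one step at a time. If [s] lies below [t] in [I] and steps to
    [s'], self-simulation gives a step from [t] to some [u] above [s'], and the invariant gives [t']
    in [I] above [u]; transitivity puts [s'] below [t'], and [u] witnesses the [step_le] step
    ([ssts_invariant_step]). Iterating this choice from [t1] builds [shadow], which serves both runs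
    and paths. *)

Lemma ssts_invariant_step {S : Type} {step le : relation S} {I : S -> Prop}
    {s t s' : S} :
  is_ssts step le -> reach_invariant step le I ->
  le s t -> I t -> step s s' ->
  exists t' : S, step_le step le t t' /\ le s' t' /\ I t'.
Proof.
move=> [[_ le_trans] sim] inv le_st It step_ss'.
have [u [step_tu le_s'u]] := sim _ _ _ le_st step_ss'.
have [t' [It' le_ut']] := inv _ _ It step_tu.
exists t'; split; first by exists u.
by split=> //; apply: le_trans le_s'u le_ut'.
Qed.

(* Chosen by epsilon, so that one function serves both paths and runs; the value
   at i.+1 is meaningful only as long as s steps from j to j.+1 for all j <= i. *)
Fixpoint shadow {S : Type} (step le : relation S) (I : S -> Prop)
    (t0 : S) (s : nat -> S) (i : nat) : S :=
  if i is j.+1 then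
    let t := shadow step le I t0 s j in
    epsilon (inhabits t)
      (fun t' => step_le step le t t' /\ le (s j.+1) t' /\ I t')
  else t0.

Section Shadow.

Context {S : Type} {step le : relation S} {I : S -> Prop}.
Context (hS : is_ssts step le) (hI : reach_invariant step le I).
Context {t0 : S} {s : nat -> S} (le0 : le (s 0) t0) (It0 : I t0).

Local Notation t := (shadow step le I t0 s).

(** By [ssts_invariant_step] the predicate under [epsilon] is satisfiable, so the chosen state
    satisfies it. *)
Lemma shadow_step {i : nat} :
  le (s i) (t i) -> I (t i) -> step (s i) (s i.+1) ->
  step_le step le (t i) (t i.+1) /\ le (s i.+1) (t i.+1) /\ I (t i.+1).
Proof.
move=> le_i I_i step_i.
exact: (epsilon_spec _ _ (ssts_invariant_step hS hI le_i I_i step_i)).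
Qed.

(** Only the steps before [i] are assumed, so that a finite path padded to a sequence on [nat] also
    qualifies. *)
Lemma shadow_invariant {i : nat} :
  (forall j, j < i -> step (s j) (s j.+1)) -> le (s i) (t i) /\ I (t i).
Proof.
elim: i => [//|i IHi] steps.
have [le_i I_i] := IHi (fun j lt_ji => steps j (ltnW lt_ji)).
by have [_] := shadow_step le_i I_i (steps i (ltnSn i)).
Qed.

Lemma shadow_path {i : nat} :
  (forall j, j <= i -> step (s j) (s j.+1)) ->
  step_le step le (t i) (t i.+1).
Proof.
move=> steps.
have [le_i I_i] := shadow_invariant (fun j lt_ji => steps j (ltnW lt_ji)).
by have [] := shadow_step le_i I_i (steps i (leqnn i)).
Qed.

End Shadow.

Theorem theorem2 (S : Type) (step le : relation S) (I : S -> Prop)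
    (hS : is_ssts step le) (hI : reach_invariant step le I)
    (s1 t1 : S) (hle : le s1 t1) (ht1 : I t1) :
  (forall (n : nat) (s : 'I_n.+1 -> S),
     s ord0 = s1 -> is_path step s ->
     exists t : 'I_n.+1 -> S,
       t ord0 = t1 /\ is_path (step_le step le) t /\
       (forall i : 'I_n.+1, le (s i) (t i) /\ I (t i)))
  /\
  (forall s : nat -> S,
     s 0 = s1 -> is_run step s ->
     exists t : nat -> S,
       t 0 = t1 /\ is_run (step_le step le) t /\
       (forall i : nat, le (s i) (t i) /\ I (t i))).
Proof.
split=> [n s s0 path_s | s s0 run_s]; last first.
  exists (shadow step le I t1 s); split=> //.
  rewrite -s0 in hle; split=> i.
    exact: (shadow_path hS hI hle ht1 (fun j _ => run_s j)).
  exact: (shadow_invariant hS hI hle ht1 (fun j _ => run_s j)).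
(* Beyond [n], [inord] defaults to [ord0]; these values are harmless, since only steps from [j < n]
   get used. *)
pose s' i := s (inord i).
have le0 : le (s' 0) t1 by rewrite /s' -[0]/(val (@ord0 n)) inord_val s0.
have steps j : j < n -> step (s' j) (s' j.+1).
  by move=> lt_jn; apply: path_s; rewrite !inordK // ltnS ltnW.
exists (fun i => shadow step le I t1 s' i); split=> //; split=> [i j ji | i].
  (* As [j] is an index of the path, [i < n], so every step up to [i] is a genuine one. *)
  rewrite ji; apply: (shadow_path hS hI le0 ht1) => k le_ki; apply: steps.
  by rewrite (leq_ltn_trans le_ki) // -ltnS -ji.
rewrite -{1}(inord_val i); apply: (shadow_invariant hS hI le0 ht1) => j lt_ji.
by apply: steps; rewrite (leq_trans lt_ji) // -ltnS.
Qed.
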